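(* Kontsevich's conjecture is false: it is not true that for every finite graph $G$ the function $[Y_G]$ is given by a polynomial in $\mathbf{Z}[q]$. That is, there exists a finite graph $G$ for which there is no polynomial $f\in\mathbf{Z}[q]$ with $\#Y_G(\mathbf{F}_q)=f(q)$ for all prime powers $q$.
   Context: Graphs are finite; loops and multiple edges are allowed. For a graph $G$ with vertex set $V(G)$ and edge set $E$, a spanning tree is a subgraph $T$ with $V(T)=V(G)$ that is a tree. With one variable $x_e$ for each edge $e$, let $P_G=\sum_T\prod_{e\notin T}x_e$, the sum running over all spanning trees $T$ of $G$. $Y_G$ is the complement in $\mathbf{A}^E_{\mathbf{Z}}$ of the hypersurface $V(P_G)$, so $\#Y_G(\mathbf{F}_q)=\#\{x\in\mathbf{F}_q^E : P_G(x)\ne 0\}$, and $[Y_G]$ is the function $q\mapsto \#Y_G(\mathbf{F}_q)$ on prime powers $q$. *)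

(* Defs.v *)
From HB Require Import structures.
From mathcomp Require Import all_boot all_order all_algebra all_field.
From mathcomp Require Import mpoly.

Set Implicit Arguments.
Unset Strict Implicit.
Unset Printing Implicit Defensive.

Import GRing.Theory.
Local Open Scope ring_scope.

(* Loops ([ends e = (v, v)]) and multiple edges are allowed.  The order of the
   pair [ends e] carries no meaning: it is only used through [joins]. *)
Record graph := Graph {
  vertex : finType;
  edge : finType;
  ends : edge -> vertex * vertex }.

Section Graphs.

Variable G : graph.
Implicit Types (T : {set edge G}) (u v : vertex G).

Definition joins (e : edge G) u v : bool :=
  (ends e == (u, v)) || (ends e == (v, u)).

(* A set [T] of edges stands for the subgraph with edge set [T] and with all
   the vertices of [G]. *)
Definition connected T : bool :=
  (0 < #|vertex G|)%N &&
  [forall u, forall v, connect (fun x y => [exists e in T, joins e x y]) u v].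

(* A cycle of length k.+1 has k.+1 distinct vertices and k.+1 distinct edges:
   a loop is a cycle of length 1, two parallel edges form a cycle of length 2. *)
Definition is_cycle T (k : nat)
    (v : {ffun 'I_k.+1 -> vertex G}) (e : {ffun 'I_k.+1 -> edge G}) : bool :=
  [&& injectiveb v, injectiveb e &
      [forall i, (e i \in T) && joins (e i) (v i) (v (ordS i))]].

(* The vertices of a cycle are distinct, so its length is at most #|vertex G|:
   bounding k loses no cycle. *)
Definition acyclic T : bool :=
  ~~ [exists k : 'I_#|vertex G|,
       exists v : {ffun 'I_k.+1 -> vertex G},
       exists e : {ffun 'I_k.+1 -> edge G}, is_cycle T v e].

Definition spanning_tree T : bool := connected T && acyclic T.

(* The variable x_e is 'X_(enum_rank e). *)
Definition graph_poly : {mpoly int[#|edge G|]} :=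
  \sum_(T : {set edge G} | spanning_tree T)
    \prod_(e | e \notin T) 'X_(enum_rank e).

Definition graph_poly_at (F : finFieldType) (x : {ffun edge G -> F}) : F :=
  (map_mpoly intr graph_poly).@[fun i => x (enum_val i)].

(* Y_G(F) *)
Definition Y_points (F : finFieldType) : {set {ffun edge G -> F}} :=
  [set x | graph_poly_at x != 0].

(* [F] ranges over all finite fields, so #|F| ranges over all prime powers. *)
Definition polynomially_countable : Prop :=
  exists f : {poly int},
    forall F : finFieldType, #|Y_points F|%:Z = f.[#|F|%:Z].

End Graphs.

(* Main.v *)
From Stdlib Require Import Classical.
From mathcomp Require Import mpoly.
From mathcomp Require Import all_boot all_order all_algebra all_field.
From mathcomp Require Import ring zify.
Require Import Defs.

(* After Stanley and Belkale-Brosnan.  Suppose every [Y_G] is counted by a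
   polynomial.

   For a fixed edge, a weighted spanning tree sum is [x A + z B] in homogeneous
   coordinates [(x : z)]; [P_G] has [z = 1] at every edge, the Laplacian
   determinant has [x = 1].  Deleting the edge gives [A], doubling it gives
   [x x' A + (x + x') B], and the three resulting counts determine the number
   of [y] with [A + y B != 0], where [y] ranges over the field or over its
   non-zero elements.  So Laplacian determinants with free, non-zero or zero
   edge weights are counted by rational functions of [q].

   If one vertex is joined to all the others by freely weighted edges, the
   reduced Laplacians are exactly the symmetric matrices with free diagonal and
   prescribed off-diagonal supports.  Bordering such a matrix by a free row and
   column changes its corank by at most one, with transition counts that depend
   only on [q] and the corank; hence the matrices of any given corank are also
   counted by rational functions.

   Finally take the symmetric matrices of size 7 + 7 and rank 3 whose
   off-diagonal block has as zeros the incidences of the Fano plane.  Such a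
   block represents the Fano plane over the field, so there are none in odd
   characteristic, while there is one over F_2: the count is not rational. *)

Set Implicit Arguments.
Unset Strict Implicit.
Unset Printing Implicit Defensive.

Import Order.TTheory GRing.Theory Num.Theory.
Local Open Scope ring_scope.

(** * The matrix-tree theorem *)

(** The bordered matrix [B y] has determinant [\det (M + y *: (c *m r))], and only its first row
    depends on [y], in an affine way; the determinant is linear in that row. *)
Lemma det_rank1_affine (R : comNzRingType) n (M : 'M[R]_n) (c : 'cV_n)
    (r : 'rV_n) z :
  \det (M + z *: (c *m r)) = \det M + z * (\det (M + c *m r) - \det M).
Proof.
pose B y := block_mx 1%:M (- (y *: r)) c M.
have detB y : \det (B y) = \det (M + y *: (c *m r)).
  have -> : B y = block_mx 1%:M 0 c 1%:M
                  *m block_mx 1%:M (- (y *: r)) 0 (M + y *: (c *m r)).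
    rewrite mulmx_block ?mul1mx ?mul0mx ?mulmx1 ?mulmx0 ?addr0 ?add0r.
    by rewrite mulmxN -scalemxAr addrCA addNr addr0.
  by rewrite det_mulmx det_lblock det_ublock !det1 !mul1r.
have e0 : \det M = \det (B 0) by rewrite detB scale0r addr0.
have e1 : \det (M + c *m r) = \det (B 1) by rewrite detB scale1r.
rewrite -detB e1 e0.
have -> : \det (B 0) + z * (\det (B 1) - \det (B 0))
          = (1 - z) * \det (B 0) + z * \det (B 1) by ring.
apply: (@determinant_multilinear _ _ _ _ _ (0 : 'I_(1 + n))).
- apply/rowP => j; rewrite !mxE; case: (splitP (0 : 'I_(1 + n))) => // k _.
  rewrite !mxE; case: split => l; rewrite !mxE; ring.
- apply/matrixP => i j; rewrite !mxE.
  by case: splitP => k; rewrite ?mxE // /= ord1.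
- apply/matrixP => i j; rewrite !mxE.
  by case: splitP => k; rewrite ?mxE // /= ord1.
Qed.

Section Incidence.
Variables (R : comNzRingType) (N : nat).
Implicit Types (e : option 'I_N * option 'I_N) (M : 'M[R]_N).

(** [None] is a ground vertex whose coordinate is dropped, so the Laplacians built from these rows
    are reduced ones. *)
Definition vertex_row (u : option 'I_N) : 'rV[R]_N :=
  if u is Some i then delta_mx 0 i else 0.

Definition incidence e : 'rV[R]_N := vertex_row e.1 - vertex_row e.2.

Definition edge_lap e : 'M[R]_N := (incidence e)^T *m incidence e.

(* The pair [(x, z)] stands for the edge weight [z / x]: with all [x = 1] this is
   the determinant of the weighted Laplacian (plus [M]), with all [z = 1] and
   [M = 0] it is the graph polynomial. *)
Fixpoint netdet (ws : seq ((option 'I_N * option 'I_N) * (R * R))) M : R :=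
  if ws is (e, (x, z)) :: ws' then
    x * netdet ws' M + z * (netdet ws' (M + edge_lap e) - netdet ws' M)
  else \det M.

(** Unfolded, [netdet ws M] is a combination of determinants at shifts of [M], with coefficients
    independent of [M]; each of them is affine by [det_rank1_affine]. *)
Lemma netdet_affine ws M e z :
  netdet ws (M + z *: edge_lap e)
  = netdet ws M + z * (netdet ws (M + edge_lap e) - netdet ws M).
Proof.
elim: ws M => [|[e' [x' z']] ws IH] M /=; first exact: det_rank1_affine.
rewrite addrAC !IH [M + edge_lap e + _]addrAC; ring.
Qed.

(** The pair [(1, 0)] amounts to deleting the edge, and [(0, 1)] isolates the coefficient of [z]. *)
Lemma netdet_single ws1 ws2 e x z M :
  netdet (ws1 ++ (e, (x, z)) :: ws2) M
  = x * netdet (ws1 ++ ws2) M + z * netdet (ws1 ++ (e, (0, 1)) :: ws2) M.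
Proof.
elim: ws1 M => [|[e' [x' z']] ws1 IH] M /=; first by ring.
by rewrite !IH; ring.
Qed.

(** The coefficient of [z1 * z2] is a second difference along a single edge, which vanishes by
    [netdet_affine]. *)
Lemma netdet_double ws1 ws2 e x1 z1 x2 z2 M :
  netdet (ws1 ++ (e, (x1, z1)) :: (e, (x2, z2)) :: ws2) M
  = (x1 * x2) * netdet (ws1 ++ ws2) M
    + (x1 * z2 + x2 * z1) * netdet (ws1 ++ (e, (0, 1)) :: ws2) M.
Proof.
elim: ws1 M => [|[e' [x' z']] ws1 IH] M /=; last by rewrite !IH; ring.
have -> : M + edge_lap e + edge_lap e = M + 2 *: edge_lap e.
  by rewrite scaler_nat mulr2n addrA.
by rewrite netdet_affine; ring.
Qed.

Lemma netdet_det (ws : seq ((option 'I_N * option 'I_N) * R)) M :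
  netdet [seq (w.1, (1, w.2)) | w <- ws] M
  = \det (M + \sum_(w <- ws) w.2 *: edge_lap w.1).
Proof.
elim: ws M => [|[e z] ws IH] M /=; first by rewrite big_nil addr0.
rewrite big_cons mul1r -netdet_affine IH addrA; congr (\det (_ + _ + _)).
Qed.

Fixpoint iter_diff (ks : seq (option 'I_N * option 'I_N)) M : R :=
  if ks is e :: ks' then iter_diff ks' (M + edge_lap e) - iter_diff ks' M
  else \det M.

End Incidence.

Arguments vertex_row R {N} u.
Arguments incidence R {N} e.
Arguments edge_lap R {N} e.

Section IterDiff.
Variables (R : comNzRingType) (N : nat).
Implicit Types (e : option 'I_N * option 'I_N) (M : 'M[R]_N).

Lemma map_edge_lap (S : comNzRingType) (f : {rmorphism R -> S}) e :
  map_mx f (edge_lap R e) = edge_lap S e.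
Proof.
rewrite /edge_lap map_mxM -map_trmx; congr (_^T *m _);
  by rewrite map_mxB; congr (_ - _); case: e => [[i|] [j|]] //=;
     rewrite ?map_delta_mx ?map_mx0.
Qed.

Let lap_poly ks M : {poly R} :=
  \det (map_mx polyC M + 'X *: \sum_(e <- ks) edge_lap {poly R} e).

Let lap_poly_cons e ks M :
  lap_poly (e :: ks) M
  = lap_poly ks M + 'X * (lap_poly ks (M + edge_lap R e) - lap_poly ks M).
Proof.
rewrite /lap_poly big_cons scalerDr [X in _ + X]addrC addrA.
rewrite [LHS](netdet_affine [::]) /= map_mxD map_edge_lap.
by rewrite [_ + edge_lap _ _ + _]addrAC.
Qed.

Let size_lap_poly ks M : (size (lap_poly ks M) <= (size ks).+1)%N.
Proof.
elim: ks M => [|e ks IH] M.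
  by rewrite /lap_poly big_nil scaler0 addr0 det_map_mx size_polyC leq_b1.
rewrite lap_poly_cons (leq_trans (size_polyD _ _)) // geq_max.
rewrite (leq_trans (IH _)) //= mulrC (leq_trans (size_polyMleq _ _)) //.
rewrite size_polyX addn2 /= ltnS (leq_trans (size_polyD _ _)) //.
by rewrite geq_max size_polyN !IH.
Qed.

Let iter_diff_coef ks M : iter_diff ks M = (lap_poly ks M)`_(size ks).
Proof.
elim: ks M => [|e ks IH] M /=.
  by rewrite /lap_poly big_nil scaler0 addr0 det_map_mx coefC.
(* The degree bound kills the contribution of [lap_poly ks M]; the factor ['X] brings the difference
   of the two top coefficients into the new top degree. *)
rewrite lap_poly_cons coefD nth_default ?size_lap_poly // add0r.
by rewrite mulrC coefMX /= coefB !IH.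
Qed.

(* [det ('X L) = 'X^N det L] has only one non-zero coefficient, and the iterated
   difference of [det] along [ks] is the coefficient of degree [size ks]. *)
Lemma iter_diff0 ks :
  iter_diff ks 0
  = if size ks == N then \det (\sum_(e <- ks) edge_lap R e : 'M[R]_N) else 0.
Proof.
rewrite iter_diff_coef /lap_poly map_mx0 add0r detZ.
have -> : \sum_(e <- ks) edge_lap {poly R} e
          = map_mx polyC (\sum_(e <- ks) edge_lap R e).
  by rewrite raddf_sum /=; apply: eq_bigr => e _; rewrite map_edge_lap.
rewrite det_map_mx mulrC coefCM coefXn.
by case: (size ks == N); rewrite ?mulr1 ?mulr0.
Qed.

End IterDiff.

Lemma big_subset_cons (R : nmodType) (E : finType) (e : E) (s : seq E)
    (f : {set E} -> R) : e \notin s ->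
  \sum_(T : {set E} | T \subset e :: s) f T
  = \sum_(T : {set E} | T \subset s) f T
    + \sum_(T : {set E} | T \subset s) f (e |: T).
Proof.
move=> es; rewrite (bigID (fun T : {set E} => e \in T)) /= addrC.
congr (_ + _).
  apply: eq_bigl => T; apply/andP/idP => [[/subsetP Ts eT]|/subsetP Ts].
    apply/subsetP => a aT; have := Ts a aT; rewrite inE => /orP[/eqP ae|//].
    by rewrite -ae aT in eT.
  split; last by apply: contra es => /Ts.
  by apply/subsetP => a /Ts; rewrite inE orbC => ->.
rewrite (reindex_onto (fun T => e |: T) (fun T => T :\ e)) /=; last first.
  by move=> T /andP[_ eT]; rewrite setD1K.
apply: eq_bigl => T; rewrite setU11 andbT; apply/andP/idP.
  case=> /subsetP Ts /eqP eT; apply/subsetP => a aT.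
  have := Ts a; rewrite in_setU1 aT orbT inE => /(_ isT)/orP[/eqP ae|//].
  by move: aT; rewrite -eT ae setD11.
move=> /subsetP Ts; split.
  by apply/subsetP => a; rewrite !inE => /orP[->//|/Ts ->]; rewrite orbT.
by rewrite setU1K //; apply: contra es => /Ts.
Qed.

(** At each edge the recursion offers a term with factor [x e] and a difference term; [T] is the set
    of edges where the difference is chosen. *)
Lemma netdet_subsets (R : comNzRingType) N (E : finType)
    (nd : E -> option 'I_N * option 'I_N) (x : E -> R) (s : seq E) M :
    uniq s ->
  netdet [seq (nd e, (x e, 1)) | e <- s] M
  = \sum_(T : {set E} | T \subset s)
      (\prod_(e <- s | e \notin T) x e)
      * iter_diff [seq nd e | e <- s & e \in T] M.
Proof.
elim: s M => [|e s IH] M /=.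
  move=> _; rewrite (big_pred1 set0) => [|T]; first by rewrite big_nil mul1r.
  rewrite /= -subset0; apply/subsetP/subsetP => H a /H; by rewrite !inE.
case/andP=> es us; rewrite big_subset_cons // !IH // mul1r.
have notin (T : {set E}) : T \subset s -> e \notin T.
  by move/subsetP/(_ e) => Ts; apply: contra es.
have memU (T : {set E}) a : a \in s -> (a \in e |: T) = (a \in T).
  move=> as_; rewrite in_setU1; case: eqP => // ae.
  by rewrite ae (negPf es) in as_.
have prodU (T : {set E}) : \prod_(a <- s | a \notin e |: T) x a
               = \prod_(a <- s | a \notin T) x a.
  rewrite big_seq_cond [RHS]big_seq_cond; apply: eq_bigl => a.
  by case as_: (a \in s); rewrite //= memU.
have filterU (T : {set E}) : [seq a <- s | a \in e |: T] = [seq a <- s | a \in T].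
  by apply: eq_in_filter => a as_; rewrite memU.
rewrite mulr_sumr [in RHS]addrC -sumrB.
rewrite [RHS]addrC.
congr (_ + _); apply: eq_bigr => T Ts; rewrite big_cons.
  by rewrite (notin _ Ts) (negPf (notin _ Ts)) /= mulrA.
by rewrite setU11 /= prodU filterU -mulrBr.
Qed.

(** * Cycles and redundant edges *)

Section Cycles.
Variable G : graph.
Implicit Types (S T : {set edge G}) (u v : vertex G).

Definition adj T u v : bool := [exists e in T, joins e u v].

Lemma joinsC (e : edge G) u v : joins e u v = joins e v u.
Proof. by rewrite /joins orbC. Qed.

Lemma adj_sym T : symmetric (adj T).
Proof. by move=> u v; apply: eq_existsb => e; rewrite joinsC. Qed.

Lemma connect_adj_sym T : connect_sym (adj T).
Proof. exact/sym_connect_sym/adj_sym. Qed.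

Lemma connectedP T :
  reflect ((0 < #|vertex G|)%N /\ forall u v, connect (adj T) u v)
          (connected T).
Proof.
apply: (iffP andP) => -[V0 H]; split=> //.
  by move=> u v; move/forallP/(_ u)/forallP/(_ v): H.
by apply/forallP => u; apply/forallP => v; apply: H.
Qed.

Lemma connectedS S T : S \subset T -> connected S -> connected T.
Proof.
move=> /subsetP ST /connectedP[V0 H]; apply/connectedP; split=> // u v.
apply: connect_sub (H u v) => a b /existsP[e /andP[eS ab]].
by apply: connect1; apply/existsP; exists e; rewrite ST.
Qed.

(** The other edges of the cycle lead from [v ord0] to [v ord_max], which replaces every use of the
    last edge. Injectivity of [e] ensures that this detour avoids the removed edge. *)
Lemma cycle_edge_redundant T k (v : {ffun 'I_k.+1 -> vertex G}) e :
  is_cycle T v e -> connected T -> connected (T :\ e ord_max).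
Proof.
case/and3P=> _ /injectiveP e_inj /forallP cyc /connectedP[V0 H].
apply/connectedP; split=> // u w.
have path0 j (jk : (j < k.+1)%N) :
    connect (adj (T :\ e ord_max)) (v ord0) (v (Ordinal jk)).
  elim: j jk => [|j IH] jk.
    by rewrite (_ : Ordinal jk = ord0) ?connect0 //; apply/val_inj.
  have jk' : (j < k.+1)%N by apply: ltn_trans jk.
  apply: connect_trans (IH jk') _; apply: connect1; apply/existsP.
  exists (e (Ordinal jk')); have /andP[eT] := cyc (Ordinal jk').
  have -> : ordS (Ordinal jk') = Ordinal jk.
    by apply/val_inj; rewrite /= modn_small.
  move=> ->; rewrite in_setD1 eT !andbT; apply/eqP => /e_inj/(congr1 val) /=.
  by move=> jk0; move: jk; rewrite jk0 ltnn.
have pathk : connect (adj (T :\ e ord_max)) (v ord0) (v ord_max).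
  have := path0 _ (ltnSn k).
  by rewrite (_ : Ordinal _ = ord_max) //; apply/val_inj.
have wrap : ordS (@ord_max k) = ord0 by apply/val_inj; rewrite /= modnn.
apply: connect_sub (H u w) => a b /existsP[f /andP[fT fab]].
have [fe|fe] := eqVneq f (e ord_max); last first.
  by apply: connect1; apply/existsP; exists f; rewrite !inE fe fT.
have /andP[_] := cyc ord_max; rewrite wrap -fe.
move: fab; rewrite /joins => /orP[]/eqP-> /orP[]/eqP[-> ->];
  by rewrite fe // connect_adj_sym.
Qed.

(** A path without repeated vertices between the ends of [e0] inside [T :\ e0] is closed up to a
    cycle by [e0]; for a loop the path is empty. *)
Lemma redundant_edge_cycle T e0 :
  e0 \in T -> connected (T :\ e0) -> ~~ acyclic T.
Proof.
move=> e0T /connectedP[V0 H]; rewrite negbK.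
case e0ab : (ends e0) => [a b].
have /connectP[p0 ap0 bE] := H a b.
case/shortenP: ap0 bE => p ap up _ bE {p0}.
pose k := size p.
have kV : (k < #|vertex G|)%N.
  by have := max_card (mem (a :: p)); rewrite (card_uniqP up) /=.
pose v := [ffun i : 'I_k.+1 => nth a (a :: p) i].
have adjv (i : nat) : (i < k)%N ->
    adj (T :\ e0) (nth a (a :: p) i) (nth a (a :: p) i.+1).
  by move=> ik; move/(pathP a)/(_ i ik): ap.
(* The default [e0] is never reached before the last index, where [e'] imposes [e0] anyway. *)
pose e := [ffun i : 'I_k.+1 =>
  odflt e0 [pick f in T :\ e0 | joins f (nth a (a :: p) i) (nth a (a :: p) i.+1)]].
pose e' := [ffun i : 'I_k.+1 => if i == ord_max then e0 else e i].
have eP (i : 'I_k.+1) : i != ord_max ->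
    e' i \in T :\ e0 /\ joins (e' i) (v i) (v (ordS i)).
  move=> im; rewrite !ffunE (negPf im).
  have ik : (i < k)%N.
    by rewrite ltn_neqAle -ltnS ltn_ord andbT.
  rewrite [val (ordS i)]/= modn_small ?ltnS //.
  case: pickP => [f /andP[]//|] none.
  by have /existsP[f] := adjv i ik; rewrite none.
have vi : injective v.
  by move=> i j; rewrite !ffunE => /eqP; rewrite nth_uniq // => /eqP/val_inj.
have e'max : e' ord_max = e0 by rewrite ffunE eqxx.
apply/existsP; exists (Ordinal kV); apply/existsP; exists v.
apply/existsP; exists e'; apply/and3P; split.
- exact/injectiveP.
- apply/injectiveP => i j.
  have [->|im] := eqVneq i ord_max.
    have [->//|jm] := eqVneq j ord_max; rewrite e'max => e0j.
    by have [] := eP j jm; rewrite -e0j setD11.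
  have [->|jm] := eqVneq j ord_max.
    by rewrite e'max => e0i; have [] := eP i im; rewrite e0i setD11.
  have [_ ji] := eP i im; have [_ jj] := eP j jm => eij.
  (* An edge shared by steps [i] and [j] has the same two ends in both; as the vertices are
     distinct, either [i = j], or [i = j + 1] and [j = i + 1], which is absurd. *)
  move: ji jj; rewrite -eij /joins.
  have ik : (i < k)%N by rewrite ltn_neqAle -ltnS ltn_ord andbT.
  have jk : (j < k)%N by rewrite ltn_neqAle -ltnS ltn_ord andbT.
  move=> /orP[]/eqP-> /orP[]/eqP[] /vi v1 /vi v2; apply/val_inj => //;
    move: (congr1 val v1) (congr1 val v2) => /=; rewrite ?modn_small ?ltnS //;
    lia.
- apply/forallP => i; have [->|im] := eqVneq i ord_max.
    rewrite e'max e0T /= /joins e0ab !ffunE /=.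
    by rewrite modnn /= bE (last_nth a) eqxx orbT.
  by have [/setD1P[_ ->] ->] := eP i im.
Qed.

End Cycles.

Lemma vertex_row_dot (R : comNzRingType) N (v : 'rV[R]_N) (u : option 'I_N) :
  v *m (vertex_row R u)^T = (if u is Some i then v 0 i else 0)%:M.
Proof.
apply/matrixP => i j; rewrite !ord1 !mxE eqxx mulr1n.
case: u => [k|] /=; last by apply: big1 => l _; rewrite !mxE mulr0.
rewrite (bigD1 k) //= big1 => [|l lk]; first by rewrite !mxE !eqxx mulr1 addr0.
by rewrite !mxE (negPf lk) mulr0.
Qed.

Lemma vertex_rowE (R : comNzRingType) N (u : option 'I_N) j :
  vertex_row R u 0 j = (u == Some j)%:R.
Proof.
by case: u => [i|]; rewrite /vertex_row mxE //= eq_sym.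
Qed.

Lemma incidenceE (R : comNzRingType) N (e : option 'I_N * option 'I_N) j :
  incidence R e 0 j = (e.1 == Some j)%:R - (e.2 == Some j)%:R.
Proof. by rewrite -!vertex_rowE mxE [X in _ + X]mxE. Qed.

(** Deleting column [j] merges vertex [j] with the ground vertex, so minors of incidence matrices
    are again incidence matrices. *)
Lemma vertex_row_unlift (R : comNzRingType) N (j : 'I_N.+1) k u :
  vertex_row R (obind (unlift j) u) 0 k = vertex_row R u 0 (lift j k).
Proof.
rewrite !vertex_rowE; case: u => [i|] //=; congr (nat_of_bool _)%:R.
case: unliftP => [k' ->|->]; first exact/esym/(inj_eq (@lift_inj _ j)).
by symmetry; apply/negbTE/eqP => -[/eqP]; rewrite (negPf (neq_lift _ _)).
Qed.

(* Every row with a single non-zero entry is removed by a cofactor expansion;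
   when there is none left, the rows sum to zero. *)
Lemma det_incidence (R : idomainType) n (nd : 'I_n -> option 'I_n * option 'I_n) :
  let d := \det (\matrix_(i < n) incidence R (nd i)) in
  [\/ d = 0, d = 1 | d = -1].
Proof.
move=> d; rewrite {}/d; elim: n nd => [|n IH] nd.
  by constructor 2; rewrite det_mx00.
case: (pickP (fun i => ((nd i).1 == None) (+) ((nd i).2 == None))) => [i|allE].
  set A := \matrix_(i < _) _.
  move=> iP; have [j [s [sP rowE]]] :
      exists j, exists s : R, (s = 1 \/ s = -1) /\
        forall k, A i k = s * (k == j)%:R.
    case E : (nd i) iP => [[a|] [b|]] //= _; [exists a, 1 | exists b, (-1)];
      split; auto => k; rewrite /A mxE incidenceE E /= (inj_eq Some_inj) eq_sym.
      by rewrite subr0 mul1r.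
    by rewrite sub0r mulN1r.
  rewrite (expand_det_row A i) (bigD1 j) //= rowE eqxx mulr1 big1 ?addr0.
    rewrite /cofactor.
    have -> : row' i (col' j A) = \matrix_(k < n) incidence R
        (obind (unlift j) (nd (lift i k)).1, obind (unlift j) (nd (lift i k)).2).
      apply/matrixP => k l; rewrite !mxE /incidence /=.
      by rewrite !vertex_row_unlift.
    rewrite -signr_odd.
    case: (IH (fun k => (obind (unlift j) (nd (lift i k)).1,
                         obind (unlift j) (nd (lift i k)).2))) => ->;
      case: sP => ->; case: (odd _); rewrite ?expr0 ?expr1 ?mulr0 ?mulr1 ?mulN1r
        ?mul1r ?opprK; by [constructor 1 | constructor 2 | constructor 3].
  by move=> k kj; rewrite rowE (negPf kj) mulr0 mul0r.
constructor 1; apply/eqP; rewrite -det_tr; apply/det0P.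
exists (const_mx 1); first by apply/eqP => /rowP/(_ ord0)/eqP; rewrite !mxE oner_eq0.
have sum_row (u : option 'I_n.+1) :
    const_mx 1 *m (vertex_row R u)^T = (u != None)%:R%:M.
  by rewrite vertex_row_dot; case: u => [k|] //; rewrite mxE.
apply/rowP => i.
transitivity (((const_mx 1 : 'rV_n.+1) *m (incidence R (nd i))^T)
                (0 : 'I_1) (0 : 'I_1)).
  by rewrite !mxE; apply: eq_bigr => k _; rewrite !mxE.
rewrite /incidence raddfB /= mulmxBr !sum_row !mxE !eqxx !mulr1n.
by have := allE i; case: (_ == None); case: (_ == None); rewrite //= subrr.
Qed.

Section SpanningTrees.
Variables (F : fieldType) (N m : nat) (nd : 'I_m -> option 'I_N * option 'I_N).
Let G : graph := Graph nd.
Implicit Types S T : {set 'I_m}.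

(** Rows outside [T] are set to zero rather than removed, so that the size does not depend on
    [T]. *)
Definition incidence_mx T : 'M[F]_(m, N) :=
  \matrix_(e < m) (if e \in T then incidence F (nd e) else 0).

(** A vector killed by the incidence matrix is a potential, zero at [None], that is constant along
    the edges of [T]; connectedness means that only the zero potential exists. *)
Lemma connected_row_full T : @connected G T = row_full (incidence_mx T).
Proof.
have dotE (v : 'rV[F]_N) e : e \in T ->
    (v *m (incidence_mx T)^T) 0 e
    = (if (nd e).1 is Some i then v 0 i else 0)
      - (if (nd e).2 is Some i then v 0 i else 0).
  move=> eT; transitivity ((v *m (incidence F (nd e))^T) 0 0).
    rewrite !mxE; apply: eq_bigr => j _; by rewrite !mxE eT !mxE.
  by rewrite /incidence raddfB /= mulmxBr !vertex_row_dot !mxE !eqxx !mulr1n.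
rewrite /row_full -mxrank_tr -/(row_free _).
apply/idP/idP => [/connectedP[_ H]|H].
  apply: inj_row_free => v vA0.
  pose p u := if u is Some i then v 0 i else 0.
  have clo : closed (@adj G T) [pred u | p u == 0].
    move=> u w /existsP[e /andP[eT uw]].
    have {}uw : nd e = (u, w) \/ nd e = (w, u).
      by case/orP: uw => /eqP uw; [left | right].
    have := dotE v e eT; rewrite vA0 mxE => /esym/eqP; rewrite subr_eq0 => /eqP.
    by case: uw => -> /= pp; rewrite !inE /p pp.
  apply/rowP => i; rewrite [RHS]mxE; apply/eqP.
  have := closed_connect clo (H None (Some i)).
  by rewrite !inE /= eqxx => /esym.
apply/connectedP; split; first by apply/card_gt0P; exists None.
suff toNone u : connect (@adj G T) None u.
  move=> u v; apply: connect_trans (toNone v).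
  by rewrite connect_adj_sym.
apply: contraT => nu.
(* The indicator of the vertices that cannot be reached from [None] is a potential constant along
   edges. *)
pose v : 'rV[F]_N := \row_i (~~ connect (@adj G T) None (Some i))%:R.
have vE (w : option 'I_N) : (if w is Some i then v 0 i else 0)
                            = (~~ connect (@adj G T) None w)%:R.
  by case: w => [i|]; rewrite ?mxE // connect0.
have v0 : v *m (incidence_mx T)^T = 0.
  apply/rowP => e; rewrite [RHS]mxE.
  have [eT|eT] := boolP (e \in T); last first.
    by rewrite mxE big1 // => j _; rewrite !mxE (negPf eT) mxE mulr0.
  rewrite dotE // !vE; apply/eqP; rewrite subr_eq0; apply/eqP; congr (~~ _)%:R.
  have ww : @adj G T (nd e).1 (nd e).2.
    by apply/existsP; exists e; rewrite eT /joins /= -surjective_pairing eqxx.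
  rewrite ![connect _ None _](@connect_adj_sym G T).
  exact: (same_connect1 (@connect_adj_sym G T) ww None).
have : v = 0.
  by apply: (row_free_inj H); rewrite v0 mul0mx.
case: u nu => [i|]; last by rewrite connect0.
by move=> ni /rowP/(_ i)/eqP; rewrite !mxE ni oner_eq0.
Qed.

(** Rows forming a basis inside the full-rank incidence matrix are indexed by [N] edges, and these
    edges alone already give full rank. *)
Lemma connected_subtree T :
  @connected G T -> exists2 S : {set 'I_m}, S \subset T & #|S| = N /\ @connected G S.
Proof.
rewrite connected_row_full => fT; set f := fullrankfun fT.
(* A row outside [T] is zero, so it cannot belong to a free family. *)
have fin i : f i \in T.
  apply: contraT => nT.
  have fr : row_free (rowsub f (incidence_mx T)) := fullrowsub_free fT.
  have : delta_mx 0 i *m rowsub f (incidence_mx T) = (0 : 'rV_N).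
    rewrite -rowE; apply/rowP => j; rewrite !mxE (negPf nT); by rewrite mxE.
  rewrite -(mul0mx _ (rowsub f (incidence_mx T))) => /(row_free_inj fr)/rowP/(_ i)/eqP.
  by rewrite !mxE !eqxx oner_eq0.
exists (f @: 'I_N).
  by apply/subsetP => _ /imsetP[i _ ->].
split; first by rewrite card_imset ?card_ord //; apply: fullrankfun_inj.
rewrite connected_row_full -sub1mx.
have /submx_trans -> // : (1%:M <= rowsub f (incidence_mx T))%MS.
  by rewrite sub1mx fullrowsub_full.
rewrite (_ : rowsub f _ = rowsub f (incidence_mx (f @: 'I_N))) ?rowsub_sub //.
by apply/row_matrixP => i; apply/rowP => j; rewrite !mxE fin imset_f.
Qed.

Lemma connected_card T : @connected G T -> (N <= #|T|)%N.
Proof.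
by case/connected_subtree => S ST [<- _]; apply: subset_leq_card.
Qed.

(** There are [N + 1] vertices. An edge of [T] beyond a connected subset of [N] edges would close a
    cycle; conversely, a cycle among [N] edges would leave a connected set of [N - 1] edges, against
    [connected_card]. *)
Lemma spanning_treeE T :
  @spanning_tree G T = (#|T| == N) && @connected G T.
Proof.
rewrite /spanning_tree [RHS]andbC.
case cT : (@connected G T) => //=.
apply/idP/eqP => [acT|cardT].
  have [S ST [<- cS]] := connected_subtree cT.
  apply/eqP; rewrite eqn_leq (subset_leq_card ST) andbT leqNgt.
  apply/negP => lt_ST; have : S \proper T by rewrite properEcard ST.
  case/properP=> _ [e0 e0T e0S]; move: acT; apply/negP.
  apply: (@redundant_edge_cycle G T e0) => //.
  by apply: connectedS cS; rewrite subsetD1 ST.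
apply: contraT; rewrite negbK => /existsP[k /existsP[v /existsP[e vecyc]]].
have := connected_card (cycle_edge_redundant vecyc cT).
have eT : e ord_max \in T.
  by case/and3P: vecyc => _ _ /forallP/(_ ord_max)/andP[].
by have := cardsD1 (e ord_max) T; rewrite eT cardT add1n => {1}->; rewrite ltnn.
Qed.

(** The sum is [B^T *m B] for the square incidence matrix [B] of [T], whose determinant is 0, 1 or
    -1 and is non-zero exactly when [T] is connected. *)
Lemma det_edge_lap_sum T : #|T| = N ->
  \det (\sum_(e in T) edge_lap F (nd e) : 'M[F]_N) = (@connected G T)%:R.
Proof.
move=> cardT; pose f (i : 'I_N) := enum_val (cast_ord (esym cardT) i).
have fT i : f i \in T by apply: enum_valP.
pose B := \matrix_(i < N) incidence F (nd (f i)).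
have -> : \sum_(e in T) edge_lap F (nd e) = B^T *m B.
  rewrite big_enum_val /= (reindex (cast_ord (esym cardT))) /=; last first.
    by apply: onW_bij; exists (cast_ord cardT) => k; apply/val_inj.
  apply/matrixP => i j; rewrite summxE !mxE; apply: eq_bigr => k _.
  by rewrite !mxE big_ord1 !mxE.
have BE : B = rowsub f (incidence_mx T).
  by apply/matrixP => i j; rewrite mxE [RHS]mxE [RHS]mxE fT.
have full : row_full B = @connected G T.
  rewrite connected_row_full; apply/idP/idP; rewrite -!sub1mx => H.
    by apply: submx_trans H _; rewrite BE rowsub_sub.
  apply: submx_trans H _; apply/row_subP => e; rewrite rowK.
  case: ifP => [eT|_]; last exact: sub0mx.
  have [i ->] : exists i, e = f i.
    exists (cast_ord cardT (enum_rank_in eT e)).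
    by rewrite /f cast_ordK enum_rankK_in.
  by rewrite -(rowK (fun i => incidence F (nd (f i)))) row_sub.
rewrite det_mulmx det_tr -full row_full_unit unitmxE unitfE.
by have [->|->|->] := det_incidence F (fun i => nd (f i));
  rewrite ?eqxx ?oppr_eq0 ?oner_eq0 ?mulr0 ?mulrNN ?mulr1.
Qed.

Lemma iter_diff_spanning_tree T :
  iter_diff [seq nd e | e <- enum 'I_m & e \in T] (0 : 'M[F]_N)
  = (@spanning_tree G T)%:R.
Proof.
have -> : [seq e <- enum 'I_m | e \in T] = enum T by rewrite enumT.
rewrite iter_diff0 size_map -cardE spanning_treeE big_map big_enum.
by case: eqP => [/det_edge_lap_sum ->|_].
Qed.

Lemma netdet_graph_poly (x : 'I_m -> F) :
  netdet [seq (nd e, (x e, 1)) | e <- enum 'I_m] (0 : 'M[F]_N)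
  = \sum_(T : {set 'I_m} | @spanning_tree G T) \prod_(e | e \notin T) x e.
Proof.
rewrite netdet_subsets ?enum_uniq // [RHS]big_mkcond /=.
apply: eq_big => [T|T _]; first by apply/subsetP => e; rewrite mem_enum.
rewrite big_enum_cond /= iter_diff_spanning_tree.
by case: spanning_tree; rewrite ?mulr1 ?mulr0.
Qed.
End SpanningTrees.

(** * From graph polynomials to Laplacian determinants *)

(** The denominator must be non-zero at every integer above 1, not only as a polynomial, so that it
    can be cancelled at every field size. *)
Definition rationally_countable (a : finFieldType -> int) : Prop :=
  exists d f : {poly int},
    (forall q : nat, (1 < q)%N -> d.[q%:Z] != 0) /\
    (forall F : finFieldType, d.[#|F|%:Z] * a F = f.[#|F|%:Z]).

Lemma card_finField_gt1 (F : finFieldType) : (1 < #|F|)%N.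
Proof. exact: finNzRing_gt1. Qed.

Section RationallyCountable.
Implicit Types (a b : finFieldType -> int) (d f : {poly int}).

Lemma rationally_countable_ext a b :
  (forall F, a F = b F) -> rationally_countable a -> rationally_countable b.
Proof. by move=> ab [d [f [d0 E]]]; exists d, f; split=> // F; rewrite -ab. Qed.

Lemma rationally_countable_poly f :
  rationally_countable (fun F => f.[#|F|%:Z]).
Proof.
exists 1, f; split=> [q _|F]; first by rewrite hornerC oner_eq0.
by rewrite hornerC mul1r.
Qed.

Lemma rationally_countableD a b :
  rationally_countable a -> rationally_countable b ->
  rationally_countable (fun F => a F + b F).
Proof.
move=> [d [f [d0 E]]] [d' [f' [d0' E']]].
exists (d * d'), (f * d' + f' * d); split=> [q q1|F].
  by rewrite hornerM mulf_neq0 ?d0 ?d0'.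
by rewrite hornerD !hornerM -E -E'; ring.
Qed.

Lemma rationally_countableM f a :
  rationally_countable a -> rationally_countable (fun F => f.[#|F|%:Z] * a F).
Proof.
move=> [d [f' [d0 E]]]; exists d, (f * f'); split=> // F.
by rewrite hornerM -E; ring.
Qed.

Lemma rationally_countable_div d a :
  (forall q : nat, (1 < q)%N -> d.[q%:Z] != 0) ->
  rationally_countable (fun F => d.[#|F|%:Z] * a F) -> rationally_countable a.
Proof.
move=> d0 [d' [f [d0' E]]]; exists (d' * d), f; split=> [q q1|F].
  by rewrite hornerM mulf_neq0 ?d0 ?d0'.
by rewrite -E hornerM; ring.
Qed.

End RationallyCountable.

Lemma graph_poly_atE (G : graph) (F : finFieldType) (x : {ffun edge G -> F}) :
  graph_poly_at x
  = \sum_(T : {set edge G} | spanning_tree T) \prod_(e | e \notin T) x e.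
Proof.
rewrite /graph_poly_at /graph_poly [map_mpoly _ _]rmorph_sum [meval _ _]rmorph_sum.
apply: eq_bigr => T _; rewrite !rmorph_prod; apply: eq_bigr => e _.
by rewrite /= map_mpolyX mevalXU enum_rankK.
Qed.

Variant weight_kind := Free | Nonzero | Zero.

(* An edge of kind [None] carries a variable of the graph polynomial, an edge of
   kind [Some k] carries a Laplacian weight restricted by [k]. *)
Definition allowed (k : option weight_kind) (F : finFieldType) (y : F) : bool :=
  match k with
  | Some Nonzero => y != 0
  | Some Zero => y == 0
  | _ => true
  end.

Definition weights (k : option weight_kind) (F : finFieldType) (y : F) : F * F :=
  if k is Some _ then (1, y) else (y, 1).

(** * Counting the weights at which a network determinant is non-zero *)

Section NetCount.
Variables (F : finFieldType) (N : nat).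
Local Notation q := (#|F|%:Z).
Local Notation slot := ((option 'I_N * option 'I_N) * option weight_kind)%type.
Implicit Types (gs : seq slot) (ws : seq ((option 'I_N * option 'I_N) * (F * F))).

(** The edges in [ws] have received their weights, those in [gs] are still to be summed over. *)
Fixpoint net_count gs ws : int :=
  if gs is (e, k) :: gs' then
    \sum_(y : F | allowed k y) net_count gs' (rcons ws (e, weights k y))
  else (netdet ws 0 != 0 : nat)%:Z.

Lemma sum_affine_neq0 (a b : F) :
  \sum_(x : F) (x * a + b != 0 : nat)%:Z
  = if a != 0 then q - 1 else q * (b != 0 : nat)%:Z.
Proof.
have [->|a0] /= := eqVneq a 0.
  under eq_bigr => x _ do rewrite mulr0 add0r.
  by rewrite sumr_const -mulr_natl natz.
rewrite (bigD1 (- b / a)) //= mulfVK // addNr eqxx add0r.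
rewrite (eq_bigr (fun=> 1)) => [|x xb].
  rewrite sumr_const -natz cardC1; have := card_finField_gt1 F.
  by case: #|F| => // n _; rewrite /= -addn1 natrD addrK.
rewrite addr_eq0; case: eqP => // xab; case/eqP: xb.
by rewrite -xab mulfK.
Qed.

Definition deleted_coef k : {poly int} :=
  match k with Free => 2%:P * 'X - 1 | Nonzero => 'X - 1 | Zero => 'X end.
Definition simple_coef k : {poly int} :=
  if k is Zero then 0 else 2%:P * ('X - 1).
Definition double_coef k : {poly int} := if k is Zero then 0 else 1.

(** Every sum depends only on which of [A] and [B] vanish. The three coefficients solve the linear
    system given by the four cases. *)
Lemma weight_identity k (A B : F) :
  q * \sum_(y : F | allowed (Some k) y) (A + y * B != 0 : nat)%:Z
  = (deleted_coef k).[q] * (A != 0 : nat)%:Z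
    + (simple_coef k).[q] * \sum_(x : F) (x * A + B != 0 : nat)%:Z
    - (double_coef k).[q]
      * \sum_(x : F) \sum_(x' : F) (x * x' * A + (x + x') * B != 0 : nat)%:Z.
Proof.
pose S := \sum_(y : F) (A + y * B != 0 : nat)%:Z.
have SE : S = if B != 0 then q - 1 else q * (A != 0 : nat)%:Z.
  by rewrite -sum_affine_neq0; apply: eq_bigr => y _; rewrite addrC.
have zeroE : \sum_(y : F | y == 0) (A + y * B != 0 : nat)%:Z = (A != 0 : nat)%:Z.
  by rewrite big_pred1_eq mul0r addr0.
have nonzeroE : \sum_(y : F | y != 0) (A + y * B != 0 : nat)%:Z
                = S - (A != 0 : nat)%:Z.
  by rewrite /S [X in _ = X - _](bigID (fun y => y == 0)) /= zeroE addrAC subrr add0r.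
have dblE : \sum_(x : F) \sum_(x' : F) (x * x' * A + (x + x') * B != 0 : nat)%:Z
   = if A != 0 then (q - 1) * (q - 1) + q * (B != 0 : nat)%:Z
     else q * (q - 1) * (B != 0 : nat)%:Z.
  (* For fixed [x] the expression is affine in the other variable, with slope [x * A + B] and
     constant term [x * B]. *)
  transitivity (\sum_(x : F) if x * A + B != 0 then q - 1
                             else q * (x * B != 0 : nat)%:Z).
    apply: eq_bigr => x _; rewrite -sum_affine_neq0; apply: eq_bigr => y _.
    by congr (nat_of_bool (_ != 0))%:Z; ring.
  have [->|A0] /= := eqVneq A 0.
    under eq_bigr => x _ do rewrite mulr0 add0r.
    have [->|B0] /= := eqVneq B 0.
      by under eq_bigr => x _ do rewrite mulr0 eqxx mulr0; rewrite big1 ?mulr0.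
    by rewrite sumr_const -mulr_natl natz; ring.
  rewrite (bigD1 (- B / A)) //= mulfVK // addNr eqxx /=.
  rewrite mulf_eq0 mulf_eq0 invr_eq0 oppr_eq0 (negPf A0) orbF orbb addrC.
  congr (_ + _); rewrite (eq_bigr (fun=> q - 1)) => [|x xb].
    rewrite sumr_const -mulr_natl natz; congr (_ * _).
    rewrite cardC1; have := card_finField_gt1 F.
    by case: #|F| => // n _; rewrite /= -addn1 PoszD addrK.
  rewrite addr_eq0; case: eqP => // xab; case/eqP: xb.
  by rewrite -xab mulfK.
rewrite dblE sum_affine_neq0.
case: k => /=; rewrite ?zeroE ?nonzeroE -/S ?SE !hornerE;
  case: (A == 0); case: (B == 0) => /=; ring.
Qed.

End NetCount.

Lemma sum_nat_of_bool (T : finType) (P b : pred T) :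
  \sum_(x | P x) (b x : nat)%:Z = #|[set x | P x && b x]|%:Z.
Proof.
rewrite cardsE -sum1_card -natz natr_sum big_mkcondr /=.
by apply: eq_bigr => x _; case: (b x).
Qed.

Section NetCountTheory.
Variables (F : finFieldType) (N : nat).
Local Notation q := (#|F|%:Z).
Local Notation slot := ((option 'I_N * option 'I_N) * option weight_kind)%type.
Implicit Types (gs : seq slot) (ws : seq ((option 'I_N * option 'I_N) * (F * F))).

(** Once all other weights are chosen this is [weight_identity], by [netdet_single] and
    [netdet_double]; the sums over the other weights commute with it. *)
Lemma net_count_identity gs ws1 ws2 e k :
  q * \sum_(y : F | allowed (Some k) y) net_count gs (ws1 ++ (e, (1, y)) :: ws2)
  = (deleted_coef k).[q] * net_count gs (ws1 ++ ws2)
    + (simple_coef k).[q] * \sum_(x : F) net_count gs (ws1 ++ (e, (x, 1)) :: ws2)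
    - (double_coef k).[q]
      * \sum_(x : F) \sum_(x' : F)
          net_count gs (ws1 ++ (e, (x, 1)) :: (e, (x', 1)) :: ws2).
Proof.
elim: gs ws2 => [|[e' k'] gs IH] ws2 /=.
  set A := netdet (ws1 ++ ws2) 0.
  set B := netdet (ws1 ++ (e, (0, 1)) :: ws2) 0.
  transitivity (q * \sum_(y : F | allowed (Some k) y) (A + y * B != 0 : nat)%:Z).
    by congr (_ * _); apply: eq_bigr => y _; rewrite netdet_single mul1r.
  rewrite weight_identity; congr (_ + _ * _ - _ * _); apply: eq_bigr => x _.
    by rewrite netdet_single mul1r.
  by apply: eq_bigr => x' _; rewrite netdet_double !mulr1.
rewrite exchange_big /= mulr_sumr.
have cons_rcons W x : rcons (ws1 ++ W) (e', weights k' x)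
                      = ws1 ++ rcons W (e', weights k' x) by rewrite rcons_cat.
transitivity (\sum_(x : F | allowed k' x)
    q * \sum_(y : F | allowed (Some k) y)
          net_count gs (ws1 ++ (e, (1, y)) :: rcons ws2 (e', weights k' x))).
  by apply: eq_bigr => x _; congr (_ * _); apply: eq_bigr => y _; rewrite cons_rcons.
rewrite (eq_bigr _ (fun x _ => IH (rcons ws2 (e', weights k' x)))).
rewrite sumrB big_split -!mulr_sumr /=; congr (_ * _ + _ * _ - _ * _).
- by apply: eq_bigr => x _; rewrite cons_rcons.
- rewrite exchange_big; apply: eq_bigr => x _; apply: eq_bigr => y _.
  by rewrite cons_rcons.
- rewrite exchange_big; apply: eq_bigr => x _.
  rewrite exchange_big; apply: eq_bigr => x' _; apply: eq_bigr => y _.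
  by rewrite cons_rcons.
Qed.

Lemma net_count_split gs1 gs2 ws e k :
  q * net_count (gs1 ++ (e, Some k) :: gs2) ws
  = (deleted_coef k).[q] * net_count (gs1 ++ gs2) ws
    + (simple_coef k).[q] * net_count (gs1 ++ (e, None) :: gs2) ws
    - (double_coef k).[q] * net_count (gs1 ++ (e, None) :: (e, None) :: gs2) ws.
Proof.
elim: gs1 ws => [|[e' k'] gs1 IH] ws /=.
  transitivity (q * \sum_(y : F | allowed (Some k) y)
                      net_count gs2 (ws ++ [:: (e, (1, y))])).
    by congr (_ * _); apply: eq_bigr => y _; rewrite cats1.
  rewrite net_count_identity cats0.
  congr (_ + _ * _ - _ * _); apply: eq_bigr => x _; first by rewrite cats1.
  by apply: eq_bigr => x' _; rewrite -cat_rcons cats1.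
rewrite !mulr_sumr -big_split -sumrB /=.
by apply: eq_bigr => y _; apply: IH.
Qed.

Lemma big_tuple_cons (R : nmodType) (T : finType) n (f : n.+1.-tuple T -> R) :
  \sum_(t : n.+1.-tuple T) f t
  = \sum_(x : T) \sum_(t : n.-tuple T) f [tuple of x :: t].
Proof.
rewrite pair_bigA /=.
rewrite (reindex (fun p : T * n.-tuple T => [tuple of p.1 :: p.2])) //=.
exists (fun t => (thead t, [tuple of behead t])) => [[x t] _|t _].
  by congr (_, _); apply/val_inj.
by rewrite -tuple_eta.
Qed.

Lemma net_count_tuple n (gs : n.-tuple slot) ws :
  net_count gs ws
  = \sum_(t : n.-tuple F | all (fun p => allowed p.1.2 p.2) (zip gs t))
      (netdet (ws ++ [seq (p.1.1, weights p.1.2 p.2) | p <- zip gs t]) 0 != 0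
       : nat)%:Z.
Proof.
rewrite [RHS]big_mkcond /=.
elim: n gs ws => [|n IH] gs ws.
  rewrite (big_pred1 [tuple]) => [|t].
    by rewrite (tuple0 gs) /= cats0.
  by symmetry; apply/eqP; apply: tuple0.
case/tupleP: gs => -[e k] gs; rewrite big_tuple_cons /= [LHS]big_mkcond /=.
apply: eq_bigr => y _; rewrite (IH gs).
case: (allowed k y) => /=; last by rewrite big1.
by apply: eq_bigr => t _; rewrite cat_rcons.
Qed.

Lemma net_count_fun (I : finType) (g : I -> slot) ws :
  net_count [seq g i | i <- enum I] ws
  = \sum_(x : {ffun I -> F} | [forall i, allowed (g i).2 (x i)])
      (netdet (ws ++ [seq ((g i).1, weights (g i).2 (x i)) | i <- enum I]) 0
       != 0 : nat)%:Z.
Proof.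
rewrite -[[seq g i | i <- enum I]]/(val (codom_tuple g)) net_count_tuple.
rewrite (reindex (fun x : {ffun I -> F} => fgraph x)) /=; last first.
  by exists Finfun => x _; rewrite ?FinfunK ?fgraphK.
have zipE (x : {ffun I -> F}) :
    zip (codom g) (fgraph x) = [seq (g i, x i) | i <- enum I].
  by rewrite fgraph_codom /codom /image_mem -zip_map.
apply: eq_big => [x|x _]; rewrite zipE; last by rewrite -map_comp.
rewrite all_map; apply/allP/forallP => H i; last by move=> _; apply: H.
by apply: H; rewrite mem_enum.
Qed.

Lemma net_count_Y_points (es : seq (option 'I_N * option 'I_N)) :
  @net_count F N [seq (e, None) | e <- es] [::]
  = #|@Y_points (Graph (tnth (in_tuple es))) F|%:Z.
Proof.
have -> : [seq (e, None : option weight_kind) | e <- es]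
          = [seq (tnth (in_tuple es) i, None) | i <- enum 'I_(size es)].
  have {1}-> : es = [seq tnth (in_tuple es) i | i <- enum 'I_(size es)].
    by rewrite map_tnth_enum.
  by rewrite -map_comp.
rewrite net_count_fun /= sum_nat_of_bool; congr Posz.
apply: eq_card => x; rewrite !inE graph_poly_atE netdet_graph_poly andbC.
by rewrite (_ : [forall i, _] = true) ?andbT //; apply/forallP.
Qed.

End NetCountTheory.

(** [net_count_split] replaces a Laplacian slot by zero, one or two graph-polynomial variables. The
    list [es] collects the edges carrying such variables, and when no slot is left the count is that
    of some [Y_points]. *)
Lemma net_count_rationally_countable N
    (gs : seq ((option 'I_N * option 'I_N) * option weight_kind)) :
  (forall G, polynomially_countable G) ->
  rationally_countable (fun F => @net_count F N gs [::]).
Proof.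
move=> all_countable; suff H es : rationally_countable
    (fun F => @net_count F N ([seq (e, None) | e <- es] ++ gs) [::]).
  exact: (H [::]).
elim: gs es => [|[e k] gs IH] es.
  have [f E] := all_countable (Graph (tnth (in_tuple es))).
  apply: rationally_countable_ext (rationally_countable_poly f) => F.
  by rewrite cats0 net_count_Y_points E.
case: k => [k|]; last first.
  apply: rationally_countable_ext (IH (rcons es e)) => F.
  by rewrite map_rcons cat_rcons.
apply: (@rationally_countable_div 'X) => [q q1|].
  by rewrite hornerX eqz_nat -lt0n ltnW.
have IH1 := IH (rcons es e); have IH2 := IH (rcons (rcons es e) e).
apply: rationally_countable_ext (rationally_countableD
  (rationally_countableD (rationally_countableM (deleted_coef k) (IH es))
                         (rationally_countableM (simple_coef k) IH1))
  (rationally_countableM (- double_coef k) IH2)) => F /=.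
by rewrite hornerX net_count_split !map_rcons !cat_rcons hornerN mulNr.
Qed.

(** * Symmetric matrices with prescribed support *)

Definition sym_pattern (t : nat -> nat -> weight_kind) (F : finFieldType) N :
    {set 'M[F]_N} :=
  [set A | (A^T == A) &&
     [forall i : 'I_N, forall j : 'I_N,
        (i < j)%N ==> allowed (Some (t i j)) (A i j)]].

Lemma sum_incidence (R : comNzRingType) N (e : option 'I_N * option 'I_N) :
  \sum_k incidence R e 0 k = (e.1 != None)%:R - (e.2 != None)%:R.
Proof.
have sumE (u : option 'I_N) : \sum_k (u == Some k)%:R = (u != None)%:R :> R.
  case: u => [i|]; last by rewrite big1.
  rewrite (bigD1 i) //= eqxx big1 ?addr0 // => k ki.
  by rewrite (inj_eq Some_inj) eq_sym (negPf ki).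
by rewrite -!sumE -sumrB; apply: eq_bigr => k _; rewrite incidenceE.
Qed.

Lemma edge_lapE (R : comNzRingType) N (e : option 'I_N * option 'I_N) k l :
  edge_lap R e k l = incidence R e 0 k * incidence R e 0 l.
Proof. by rewrite /edge_lap mxE big_ord1 [X in X * _]mxE. Qed.

Section LaplacianParametrization.
Variables (t : nat -> nat -> weight_kind) (N : nat).

(** Edges to the ground vertex free the diagonal; for [i < j] the edge between [i] and [j] carries
    the entry at [(i, j)] up to sign. All ordered pairs serve as indices, so the redundant ones,
    loops included, get weight 0. *)
Definition slot_of (s : 'I_N + 'I_N * 'I_N) :
    (option 'I_N * option 'I_N) * option weight_kind :=
  match s with
  | inl i => ((None, Some i), Some Free)
  | inr (i, j) => ((Some i, Some j), Some (if (i < j)%N then t i j else Zero))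
  end.

Variable F : finFieldType.
Implicit Types (A : 'M[F]_N) (x : {ffun 'I_N + 'I_N * 'I_N -> F}).

Let lap x : 'M[F]_N := \sum_s x s *: edge_lap F (slot_of s).1.

(** This is the inverse of [lap]: an edge avoiding the ground vertex contributes nothing to row
    sums, so the row sums are the weights of the ground edges. *)
Let coord A : {ffun 'I_N + 'I_N * 'I_N -> F} :=
  [ffun s : 'I_N + 'I_N * 'I_N => match s with
             | inl i => \sum_j A i j
             | inr (i, j) => if (i < j)%N then - A i j else 0
             end].

Let lap_sym x : (lap x)^T = lap x.
Proof.
rewrite /lap raddf_sum; apply: eq_bigr => s _ /=.
by rewrite linearZ /= /edge_lap trmx_mul trmxK.
Qed.

Let lap_off_diag x k l :
  k != l -> lap x k l = - x (inr (k, l)) - x (inr (l, k)).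
Proof.
move=> kl; rewrite summxE big_sumType /= big1 => [|i _]; last first.
  rewrite mxE edge_lapE !incidenceE /= !(inj_eq Some_inj).
  case: (eqVneq i k) => [->|ik]; last by rewrite /=; ring.
  by rewrite (negPf kl) /=; ring.
rewrite add0r (bigD1 (k, l)) //= (bigD1 (l, k)) /=; last first.
  by rewrite xpair_eqE negb_and eq_sym kl.
rewrite big1 => [|[i j] /andP[] /=]; last first.
  rewrite !xpair_eqE mxE edge_lapE !incidenceE /= !(inj_eq Some_inj).
  case: (eqVneq i k) => [->|ik] /=.
    by rewrite (negPf kl) /= => jl _; case: (eqVneq j l) jl => //= _ _; ring.
  move=> _; case: (eqVneq i l) => [->|il] /=.
    by move=> jk; rewrite (negPf jk) /=; ring.
  move=> _; case: (eqVneq j k) => [->|jk] /=; last by rewrite /=; ring.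
  by rewrite (negPf kl) /=; ring.
rewrite addr0 [X in X + _]mxE [X in _ + X]mxE !edge_lapE !incidenceE /= !eqxx.
rewrite !(inj_eq Some_inj).
by rewrite [l == k]eq_sym (negPf kl) /=; ring.
Qed.

Let lap_row_sum x k : \sum_l lap x k l = x (inl k).
Proof.
transitivity (\sum_s x s * (incidence F (slot_of s).1 0 k
                             * \sum_l incidence F (slot_of s).1 0 l)).
  rewrite (eq_bigr _ (fun l _ => summxE _ _ _ k l)) exchange_big.
  apply: eq_bigr => s _; rewrite !mulr_sumr; apply: eq_bigr => l _.
  by rewrite mxE edge_lapE.
rewrite big_sumType /= [X in _ + X]big1 ?addr0 => [|[i j] _]; last first.
  by rewrite sum_incidence subrr !mulr0.
rewrite (bigD1 k) //= [X in _ + X]big1 ?addr0 => [|i ik]; last first.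
  by rewrite !incidenceE /= (inj_eq Some_inj) (negPf ik) subrr mul0r mulr0.
by rewrite sum_incidence incidenceE /= eqxx /=; ring.
Qed.

Let admissible x := [forall s, allowed (slot_of s).2 (x s)].

Let lapK x : admissible x -> coord (lap x) = x.
Proof.
move=> /forallP xP.
have x0 (i j : 'I_N) : (j <= i)%N -> x (inr (i, j)) = 0.
  by move=> ji; have := xP (inr (i, j)); rewrite /= ltnNge ji => /eqP.
apply/ffunP => -[i|[i j]]; rewrite ffunE ?lap_row_sum //.
case: (ltnP i j) => [ij|/x0 -> //].
rewrite lap_off_diag; last by rewrite neq_ltn ij.
by rewrite (x0 j i) ?(ltnW ij) // subr0 opprK.
Qed.

Let coordK A : A^T = A -> lap (coord A) = A.
Proof.
move=> symA.
have off k l : k != l -> lap (coord A) k l = A k l.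
  move=> kl; rewrite lap_off_diag // !ffunE.
  case: (ltngtP k l) kl => [kl|lk|/val_inj ->]; last by rewrite eqxx.
    by rewrite opprK subr0.
  by rewrite oppr0 sub0r opprK -[in RHS]symA mxE.
apply/matrixP => k l; have [->|/off //] := eqVneq k l.
(* Equal row sums and equal off-diagonal entries force equal diagonal entries. *)
have := lap_row_sum (coord A) l; rewrite ffunE (bigD1 l) //= [in RHS](bigD1 l) //=.
rewrite (eq_bigr (fun j => A l j)) => [/addIr //|j jl].
by rewrite off // eq_sym.
Qed.

Let lap_sym_pattern x : admissible x -> lap x \in sym_pattern t F N.
Proof.
move=> adx; have /forallP xP := adx; rewrite inE lap_sym eqxx /=.
apply/forallP => i; apply/forallP => j; apply/implyP => ij.
have := xP (inr (i, j)); rewrite lap_off_diag ?neq_ltn ?ij //=.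
have := xP (inr (j, i)); rewrite /= ltnNge (ltnW ij) /= => /eqP ->.
by rewrite subr0 ij; case: (t i j) => //=; rewrite oppr_eq0.
Qed.

Let coord_admissible A : A \in sym_pattern t F N -> admissible (coord A).
Proof.
rewrite inE => /andP[_ /forallP AP]; apply/forallP => -[i|[i j]] //=.
rewrite ffunE; case: ifP => ij; last exact: eqxx.
have /forallP/(_ j) := AP i; rewrite ij /=.
by case: (t i j) => //=; rewrite oppr_eq0.
Qed.

Lemma net_count_sym_pattern :
  @net_count F N [seq slot_of s | s <- enum {: 'I_N + 'I_N * 'I_N}] [::]
  = #|[set A in sym_pattern t F N | \det A != 0]|%:Z.
Proof.
rewrite net_count_fun sum_nat_of_bool; congr Posz.
rewrite -(@card_in_imset _ _ coord); last first.
  move=> A B; rewrite !inE => /andP[/andP[/eqP sA _] _] /andP[/andP[/eqP sB _] _].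
  by move=> AB; rewrite -(coordK sA) -(coordK sB) AB.
apply: eq_card => x; rewrite !inE.
have detE : netdet ([::] ++ [seq ((slot_of s).1, weights (slot_of s).2 (x s))
                            | s <- enum {: 'I_N + 'I_N * 'I_N}]) 0 = \det (lap x).
  rewrite cat0s.
  have -> : [seq ((slot_of s).1, weights (slot_of s).2 (x s))
            | s <- enum {: 'I_N + 'I_N * 'I_N}]
          = [seq (w.1, (1, w.2)) | w <- [seq ((slot_of s).1, x s)
            | s <- enum {: 'I_N + 'I_N * 'I_N}]].
    by rewrite -map_comp; apply: eq_map => -[i|[i j]].
  by rewrite netdet_det add0r big_map big_enum.
rewrite detE; apply/idP/imsetP => [/andP[adx dx]|[A]].
  exists (lap x); last by rewrite lapK.
  by rewrite inE lap_sym_pattern.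
rewrite inE => /andP[AP dA] ->; rewrite [X in X && _]coord_admissible //=.
by rewrite coordK //; move: AP; rewrite inE => /andP[/eqP].
Qed.

End LaplacianParametrization.

(** * Coranks of bordered symmetric matrices *)

Lemma rank_col_mx_row (F : fieldType) m n (r : 'rV[F]_n) (A : 'M[F]_(m, n)) :
  \rank (col_mx r A) = (~~ (r <= A)%MS + \rank A)%N.
Proof.
rewrite -addsmxE; have [rA|rA] := boolP (r <= A)%MS.
  by rewrite (addsmx_idPr rA).
have capE : \rank (r :&: A)%MS = 0%N.
  apply/eqP; rewrite mxrank_eq0; apply: contraT => cap0.
  case/negP: rA; have /eqmxP/eqmx_sym rcap : (r :&: A == r)%MS.
    rewrite -(geq_leqif (mxrank_leqif_eq (capmxSl r A))).
    by rewrite (leq_trans (rank_leq_row r)) // lt0n mxrank_eq0.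
  by rewrite rcap capmxSr.
have := mxrank_sum_cap r A; rewrite capE addn0 => ->; congr (_ + _)%N.
apply/eqP; rewrite eqn_leq rank_leq_row lt0n mxrank_eq0.
by apply: contra rA => /eqP ->; rewrite sub0mx.
Qed.

Section Bordering.
Variable F : finFieldType.
Local Notation q := #|F|.

Lemma card_submx m n (A : 'M[F]_(m, n)) :
  #|[set b : 'rV[F]_n | (b <= A)%MS]| = (q ^ \rank A)%N.
Proof.
pose f (u : 'rV[F]_(\rank A)) := u *m row_base A.
have f_inj : injective f by apply: row_free_inj; apply: row_base_free.
have <- : #|{: 'rV[F]_(\rank A)}| = (q ^ \rank A)%N by rewrite card_mx mul1n.
rewrite -(card_imset predT f_inj); apply: eq_card => b.
rewrite inE -(eq_row_base A); apply/submxP/imsetP => [[u ->]|[u _ ->]]; by exists u.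
Qed.

Definition border N (A : 'M[F]_N) (d : F) (b : 'rV[F]_N) : 'M[F]_(1 + N) :=
  block_mx d%:M b b^T A.

(** By symmetry [b^T] lies outside the column space of [A], so the new column and then the new row
    each raise the rank. *)
Lemma rank_border_out N (A : 'M[F]_N) d b : A^T = A -> ~~ (b <= A)%MS ->
  \rank (border A d b) = (\rank A).+2.
Proof.
move=> symA bA; rewrite /border block_mxEv rank_col_mx_row.
have -> : \rank (row_mx b^T A) = (\rank A).+1.
  by rewrite -mxrank_tr tr_row_mx trmxK symA rank_col_mx_row bA.
suff -> : (row_mx d%:M b <= row_mx b^T A)%MS = false by [].
apply/negbTE; apply: contra bA => /submxP[u].
by rewrite mul_mx_row => /eq_row_mx[_ ->]; apply: submxMl.
Qed.

(** The new column adds nothing, and the new row is dependent on the others exactly when the Schur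
    complement [d - u A u^T] vanishes. *)
Lemma rank_border_in N (A : 'M[F]_N) u : A^T = A ->
  forall d, \rank (border A d (u *m A))
            = ((d != (u *m A *m u^T) 0 0)%R + \rank A)%N.
Proof.
move=> symA d; set b := u *m A.
have bT : b^T = A *m u^T by rewrite trmx_mul symA.
rewrite /border block_mxEv rank_col_mx_row.
have -> : \rank (row_mx b^T A) = \rank A.
  by rewrite -mxrank_tr tr_row_mx trmxK symA rank_col_mx_row submxMl.
congr (nat_of_bool (~~ _) + _)%N; apply/idP/eqP => [/submxP[v]|->].
  rewrite mul_mx_row => /eq_row_mx[dE bE].
  by rewrite -/b bE -mulmxA -bT -dE mxE eqxx mulr1n.
rewrite -mx11_scalar; apply/submxP; exists u.
by rewrite mul_mx_row bT mulmxA.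
Qed.

(** Here [k] is the corank before and [c] the corank after bordering. It drops by one for [b]
    outside the row space and any [d]; for [b] inside, it rises by one at a single value of [d] and
    stays the same at the others. *)
Lemma card_border N (A : 'M[F]_N) (k c : nat) : A^T = A -> (\rank A + k = N)%N ->
  #|[set p : F * 'rV[F]_N | (\rank (border A p.1 p.2) + c == N.+1)%N]|
  = ((k == c.+1) * (q ^ N - q ^ \rank A) * q
     + (k == c) * q ^ \rank A * q.-1
     + (k.+1 == c) * q ^ \rank A)%N.
Proof.
move=> symA rk.
pose n b := #|[set d : F | (\rank (border A d b) + c == N.+1)%N]|.
transitivity (\sum_(b : 'rV[F]_N) n b)%N.
  rewrite -sum1_card (reindex (fun p : 'rV[F]_N * F => (p.2, p.1))) /=; last first.
    by exists (fun p => (p.2, p.1)) => -[].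
  pose D b := [set d : F | (\rank (border A d b) + c == N.+1)%N].
  rewrite (eq_bigl (fun p : 'rV[F]_N * F => p.2 \in D p.1)).
    rewrite -(pair_big_dep xpredT (fun b d => d \in D b) (fun _ _ => 1%N)) /=.
    by apply: eq_bigr => b _; rewrite sum1_card.
  by move=> [b d]; rewrite !inE.
rewrite (bigID (fun b => b <= A)%MS) /= addnC.
rewrite (eq_bigr (fun=> (k == c.+1) * q)%N) => [|b bA]; last first.
  rewrite /n; have [kc|kc] := eqVneq k c.+1; [rewrite mul1n|rewrite mul0n].
    apply: eq_card => d; rewrite !inE rank_border_out //; apply/eqP; lia.
  apply: eq_card0 => d; rewrite !inE rank_border_out //; apply/eqP; lia.
rewrite sum_nat_const.
have cardA : #|[pred b : 'rV[F]_N | (b <= A)%MS]| = (q ^ \rank A)%N.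
  by rewrite -card_submx; apply: eq_card => b; rewrite !inE.
have cardnA : #|[pred b : 'rV[F]_N | ~~ (b <= A)%MS]| = (q ^ N - q ^ \rank A)%N.
  rewrite -cardA -[X in (q ^ X)%N]mul1n -(card_mx F) -(cardC [pred b | (b <= A)%MS]).
  by rewrite addKn; apply: eq_card.
rewrite cardnA -addnA; congr (_ + _)%N; first by rewrite mulnCA mulnA.
rewrite (eq_bigr (fun=> (k == c) * q.-1 + (k.+1 == c))%N) => [|b /submxP[u ->]].
  by rewrite sum_nat_const cardA; ring.
rewrite /n; set d0 := (u *m A *m u^T) 0 0.
have E d : (\rank (border A d (u *m A)) + c == N.+1)%N = ((d != d0)%R + c == k.+1)%N.
  by rewrite rank_border_in // -/d0; apply/eqP/eqP; lia.
have [kc|kc] := eqVneq k c.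
  rewrite mul1n (_ : (k.+1 == c) = false) ?addn0; last by apply/eqP; lia.
  rewrite -(cardC1 d0); apply: eq_card => d; rewrite !inE E.
  by case: (d == d0) => /=; apply/eqP; lia.
rewrite mul0n add0n; have [kc'|kc'] := eqVneq k.+1 c.
  transitivity #|pred1 d0|; last by rewrite card1.
  apply: eq_card => d; rewrite !inE E.
  by case: (d == d0) => /=; apply/eqP; lia.
apply: eq_card0 => d; rewrite !inE E; case: (d == d0) => /=; apply/eqP; lia.
Qed.

End Bordering.

Definition shift_pattern (t : nat -> nat -> weight_kind) (i j : nat) :=
  if (i, j) is (i'.+1, j'.+1) then t i' j' else Free.

Definition corank_set t (F : finFieldType) N c : {set 'M[F]_N} :=
  [set A in sym_pattern t F N | (\rank A + c == N)%N].

Lemma sym_pattern_shift t (F : finFieldType) N (A : 'M[F]_N) d b :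
  (border A d b \in sym_pattern (shift_pattern t) F (1 + N))
  = (A \in sym_pattern t F N).
Proof.
rewrite !inE /border tr_block_mx tr_scalar_mx trmxK; congr (_ && _).
  apply/eqP/eqP => [/eq_block_mx[_ _ _ ->] //|->//].
apply/forallP/forallP => H i.
  apply/forallP => j; apply/implyP => ij.
  have /forallP/(_ (rshift 1 j))/implyP/(_ ij) := H (rshift 1 i).
  by rewrite block_mxEdr.
apply/forallP => j; apply/implyP.
rewrite -[i]splitK -[j]splitK; case: (split i) => i'; case: (split j) => j' //=.
- by rewrite ord1.
- by rewrite ord1.
- by rewrite ord1.
- by move=> ij; rewrite block_mxEdr; have /forallP/(_ j')/implyP/(_ ij) := H i'.
Qed.

Lemma sym_border t (F : finFieldType) N (A' : 'M[F]_(1 + N)) :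
  A' \in sym_pattern t F N.+1 ->
  A' = border (drsubmx A') (A' 0 0) (ursubmx A').
Proof.
rewrite inE => /andP[/eqP symA _].
rewrite /border trmx_ursub symA -[LHS]submxK; congr (block_mx _ _ _ _).
by rewrite [ulsubmx A']mx11_scalar !mxE; congr (A' _ _)%:M; apply/val_inj.
Qed.

(** Bordered matrices are sorted by their lower right block, and each fibre is counted by
    [card_border]. *)
Lemma card_corank_shift t (F : finFieldType) N c :
  #|corank_set (shift_pattern t) F N.+1 c|
  = (#|corank_set t F N c.+1| * ((#|F| ^ N - #|F| ^ (N - c.+1)) * #|F|)
     + #|corank_set t F N c| * (#|F| ^ (N - c) * #|F|.-1)
     + (if c is c'.+1 then #|corank_set t F N c'| * #|F| ^ (N - c') else 0))%N.
Proof.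
pose B (A : 'M[F]_N) :=
  [set p : F * 'rV[F]_N | (\rank (border A p.1 p.2) + c == N.+1)%N].
have -> : #|corank_set (shift_pattern t) F N.+1 c|
          = (\sum_(A in sym_pattern t F N) #|B A|)%N.
  rewrite -sum1_card (partition_big (fun A' : 'M_(1 + N) => drsubmx A')
    (mem (sym_pattern t F N))) /=; last first.
    move=> A'; rewrite inE => /andP[A'P _]; move: (A'P).
    by rewrite {1}(sym_border A'P) sym_pattern_shift.
  apply: eq_bigr => A AP; rewrite sum1_card.
  have inj : injective (fun p : F * 'rV[F]_N => border A p.1 p.2).
    move=> [d b] [d' b'] /= /eq_block_mx[/matrixP/(_ 0 0)].
    by rewrite !mxE eqxx !mulr1n => -> ->.
  rewrite -(card_imset _ inj); apply: eq_card => A'.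
  rewrite [LHS]unfold_in; apply/andP/imsetP => [[]|[[d b]]].
    rewrite inE => /andP[A'P rk] /eqP <-.
    exists (A' 0 0, ursubmx A'); last by rewrite /= -(sym_border A'P).
    by rewrite inE /= -(sym_border A'P).
  rewrite inE /= => rk ->; split; first by rewrite inE sym_pattern_shift AP.
  by rewrite /border block_mxKdr.
have sumE k (x : nat) : (#|corank_set t F N k| * x
     = \sum_(A in sym_pattern t F N) ((N - \rank A == k) * x))%N.
  rewrite -sum1_card big_distrl /= (eq_bigl (fun A => (A \in sym_pattern t F N)
      && (N - \rank A == k)%N)) => [|A]; last first.
    rewrite inE; case: (A \in _) => //=.
    by have := rank_leq_row A; move=> ?; apply/eqP/eqP; lia.
  rewrite big_mkcondr /=; apply: eq_bigr => A _.
  by case: (_ == k); rewrite ?mul1n ?mul0n.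
have shiftE (x : nat) :
  ((if c is c'.+1 then #|corank_set t F N c'| * x else 0)
   = \sum_(A in sym_pattern t F N) (((N - \rank A).+1 == c) * x))%N.
  by case: c {B} => [|c]; rewrite ?sumE // big1.
(* Writing the exponent in terms of [c] makes the factor the same in both cases, as [shiftE]
   requires. *)
have -> : (if c is c'.+1 then #|corank_set t F N c'| * #|F| ^ (N - c') else 0)%N
   = (if c is c'.+1 then #|corank_set t F N c'| * #|F| ^ (N.+1 - c) else 0)%N.
  by case: c {B shiftE}.
rewrite !sumE shiftE -!big_split /=; apply: eq_bigr => A.
rewrite inE => /andP[/eqP symA _].
have rk : (\rank A + (N - \rank A) = N)%N by rewrite subnKC // rank_leq_row.
rewrite /B (card_border c symA rk).
move: rk; set k := (N - _)%N => rk.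
congr (_ + _ + _)%N.
- by case: eqP => [<-|_]; rewrite ?mul0n // !mul1n (_ : (N - k)%N = \rank A) //; lia.
- by case: eqP => [<-|_]; rewrite ?mul0n // !mul1n (_ : (N - k)%N = \rank A) //; lia.
- by case: eqP => [<-|_]; rewrite ?mul0n // !mul1n
     (_ : (N.+1 - k.+1)%N = \rank A) //; lia.
Qed.

Lemma PoszX (m n : nat) : (m ^ n)%N%:Z = m%:Z ^+ n.
Proof. by rewrite -natz natrX natz. Qed.

(* [card_corank_shift] expresses the count of corank [c] for the bordered pattern
   by the counts of coranks [c - 1], [c], [c + 1]; solve for the last one. *)
Lemma corank_rationally_countable t N c :
  (forall G, polynomially_countable G) ->
  rationally_countable (fun F => #|corank_set t F N c|%:Z).
Proof.
(* The induction on the corank leaves [t] and [N] general, because the recurrence calls on the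
   shifted pattern in size [N.+1]. Corank 0 is the determinant count. *)
move=> all_countable; elim/ltn_ind: c t N => -[_|c IH] t N.
  apply: rationally_countable_ext (net_count_rationally_countable
    [seq slot_of t s | s <- enum {: 'I_N + 'I_N * 'I_N}] all_countable) => F.
  rewrite net_count_sym_pattern; congr Posz; apply: eq_card => A; rewrite !inE.
  by rewrite addn0 -unitfE -unitmxE -row_full_unit.
have [cN|cN] := ltnP c N; last first.
  apply: rationally_countable_ext (rationally_countable_poly 0) => F.
  rewrite horner0 (_ : corank_set _ _ _ _ = set0) ?cards0 //.
  apply/setP => A; rewrite [RHS]inE inE; apply/negbTE; rewrite negb_and.
  by apply/orP; right; apply/eqP; lia.
(* This is the factor of the corank [c.+1] count in [card_corank_shift]; [c < N] keeps it non-zero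
   at every [q > 1]. *)
pose d : {poly int} := ('X^N - 'X^(N - c.+1)) * 'X.
apply: (@rationally_countable_div d) => [q q1|].
  rewrite !hornerE mulf_neq0 //; last by rewrite eqz_nat; lia.
  by rewrite subr_eq0 -!PoszX eqz_nat eqn_exp2l //; lia.
have IH1 := rationally_countableD (IH c (leqnn _) (shift_pattern t) N.+1)
  (rationally_countableM (- ('X^(N - c) * ('X - 1))) (IH c (leqnn _) t N)).
have [f fE] : exists f, rationally_countable f /\ forall F,
    f F = (if c is c'.+1 then #|corank_set t F N c'| * #|F| ^ (N - c') else 0)%N%:Z.
  case: c {cN d IH1} IH => [|c] IH.
    by exists (fun _ : finFieldType => 0); split=> //; apply: rationally_countable_ext
      (rationally_countable_poly 0) => F; rewrite horner0.
  exists (fun F : finFieldType => ('X^(N - c)).[#|F|%:Z] * #|corank_set t F N c|%:Z).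
  split; first by apply: rationally_countableM; apply: IH.
  by move=> F; rewrite hornerXn PoszM mulrC PoszX.
case: fE => f_rc fE.
apply: rationally_countable_ext (rationally_countableD IH1
  (rationally_countableM (-1) f_rc)) => F /=.
rewrite fE card_corank_shift !hornerE !PoszD !PoszM.
have q1 := card_finField_gt1 F.
rewrite -subzn ?leq_exp2l ?leq_subr // !PoszX.
have -> : #|F|.-1%:Z = #|F|%:Z - 1 by lia.
ring.
Qed.

(** * The Fano plane *)

(* The points and the lines of the Fano plane are both numbered by the non-zero
   vectors of F_2^3, [i] standing for the binary digits of [i.+1]; a point lies
   on a line iff their dot product vanishes. *)
Definition fano_bit (i k : nat) : bool := odd (i.+1 %/ 2 ^ k).

Definition fano_dot (i j : nat) : bool :=
  (fano_bit i 0 && fano_bit j 0) (+) (fano_bit i 1 && fano_bit j 1)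
  (+) (fano_bit i 2 && fano_bit j 2).

Definition fano_pattern (i j : nat) : weight_kind :=
  if (i < 7 <= j)%N then if fano_dot i (j - 7) then Nonzero else Zero else Free.

(** The vectors [(A0, A1)] and [(D0, D1)] lie on the line orthogonal to [(a0, a1)]. The first is
    non-zero and spans it, so [(d0, d1)], orthogonal to the first, is orthogonal to the second. *)
Lemma fano_ratios (F : fieldType) (a0 a1 A0 A1 d0 d1 D0 D1 : F) :
  a1 != 0 -> A1 != 0 -> a0 * A0 + a1 * A1 = 0 -> a0 * D0 + a1 * D1 = 0 ->
  d0 * A0 + d1 * A1 = 0 -> d0 * D0 + d1 * D1 = 0.
Proof.
move=> a1n0 A1n0 aA aD dA; apply: (mulfI (mulf_neq0 a1n0 A1n0)); rewrite mulr0.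
have aAE : a0 * A0 = - (a1 * A1) by apply/eqP; rewrite -addr_eq0 aA.
have aDE : a1 * D1 = - (a0 * D0) by apply/eqP; rewrite -addr_eq0 addrC aD.
have dAE : d1 * A1 = - (d0 * A0) by apply/eqP; rewrite -addr_eq0 addrC dA.
transitivity (a1 * A1 * d0 * D0 + (a1 * D1) * (d1 * A1)); first by ring.
rewrite aDE dAE; transitivity (d0 * D0 * (a1 * A1 + a0 * A0)); first by ring.
by rewrite aAE subrr mulr0.
Qed.

(** The submatrix on rows [f] and columns [g] is diagonal and invertible, of the same rank as [A];
    hence [A] is the product of its columns [g], the inverse of that submatrix and its rows [f]. *)
Lemma rank3_factor (F : fieldType) m n (A : 'M[F]_(m, n))
    (f : 'I_3 -> 'I_m) (g : 'I_3 -> 'I_n) :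
  \rank A = 3%N -> (forall k l, (A (f k) (g l) != 0) = (k == l)) ->
  forall i j, A i j = \sum_k A i (g k) / A (f k) (g k) * A (f k) j.
Proof.
move=> rk diag i j.
have [V [W AE]] : exists (V : 'M[F]_(m, 3)) (W : 'M[F]_(3, n)), A = V *m W.
  by rewrite -rk; exists (col_base A), (row_base A); rewrite mulmx_base.
pose V1 := rowsub f V; pose W1 := colsub g W.
pose E := diag_mx (\row_k (A (f k) (g k))^-1) : 'M[F]_3.
have AfE k y : A (f k) y = (V1 *m W) k y.
  by rewrite AE !mxE; apply: eq_bigr => l _; rewrite !mxE.
have AgE x l : A x (g l) = (V *m W1) x l.
  by rewrite AE !mxE; apply: eq_bigr => k _; rewrite !mxE.
have VW1 : V1 *m W1 = diag_mx (\row_k A (f k) (g k)).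
  apply/matrixP => k l; rewrite [RHS]mxE [X in X *+ _]mxE.
  have -> : (V1 *m W1) k l = A (f k) (g l).
    by rewrite AfE !mxE; apply: eq_bigr => h _; rewrite !mxE.
  have := diag k l; have [->|_] := eqVneq k l; first by [].
  by move=> /negbFE/eqP.
have inv : V1 *m (W1 *m E) = 1%:M.
  rewrite mulmxA VW1 mulmx_diag; apply/matrixP => k l; rewrite !mxE.
  case: eqP => //= _; rewrite !mulr1n divff //.
  by rewrite diag.
have inv' := mulmx1C inv.
have AE' : A = V *m W1 *m E *m (V1 *m W).
  by rewrite AE -!mulmxA [W1 *m _]mulmxA [W1 *m E *m (_ *m _)]mulmxA inv' mul1mx.
rewrite {1}AE' mxE; apply: eq_bigr => k _; rewrite -AfE; congr (_ * _).
by rewrite AgE mul_mx_diag mxE [X in _ * X]mxE.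
Qed.

(* The rows and columns 0, 1, 3 (the basis vectors) of the off-diagonal block
   determine all its entries, and the nine vanishing entries among the rows and
   columns 2, 4, 5, 6 give [x + y = x + z = y + z = 0] with [x != 0]. *)
Lemma fano_rank3_char2 (F : finFieldType) :
  corank_set fano_pattern F 14 11 != set0 -> 2%:R = 0 :> F.
Proof.
case/set0Pn => A; rewrite inE => /andP[]; rewrite inE => /andP[_ /forallP AP].
rewrite -[14%N]/(3 + 11)%N eqn_add2r => /eqP rk.
pose P i : 'I_14 := inord i; pose L j : 'I_14 := inord (7 + j).
have patt i j : (i < 7)%N -> (j < 7)%N -> (A (P i) (L j) != 0) = fano_dot i j.
  move=> i7 j7; have iE : P i = i :> nat by rewrite inordK //; lia.
  have jE : L j = (7 + j)%N :> nat by rewrite inordK //; lia.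
  have /forallP/(_ (L j))/implyP := AP (P i).
  rewrite iE jE /fano_pattern i7 leq_addr addKn ltn_addr // => /(_ isT).
  by case: fano_dot => //= ->.
pose s (k : 'I_3) : nat := nth 0%N [:: 0; 1; 3]%N k.
have s7 k : (s k < 7)%N by case: k => -[|[|[|]]].
have fac := rank3_factor rk (f := fun k => P (s k)) (g := fun k => L (s k)).
have {}fac i j : A i j = \sum_k A i (L (s k)) / A (P (s k)) (L (s k)) * A (P (s k)) j.
  apply: fac => k l; rewrite patt //.
  by case: k l => -[|[|[|]]] // ? [] -[|[|[|]]].
pose c u k := A (P u) (L k) / A (P k) (L k).
pose r k v := A (P k) (L v).
have facE u v : A (P u) (L v)
    = c u 0%N * r 0%N v + c u 1%N * r 1%N v + c u 3%N * r 3%N v.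
  by rewrite fac !big_ord_recl big_ord0 addr0 /= addrA.
have cn0 u k : (u < 7)%N -> (k < 7)%N -> fano_dot k k -> (c u k != 0) = fano_dot u k.
  move=> u7 k7 kk; rewrite mulf_eq0 invr_eq0 -[X in _ || X]negbK patt // kk orbF.
  by rewrite patt.
have zero u v : (u < 7)%N -> (v < 7)%N -> fano_dot u v = false ->
    c u 0%N * r 0%N v + c u 1%N * r 1%N v + c u 3%N * r 3%N v = 0.
  by move=> u7 v7 uv; rewrite -facE; apply/eqP; rewrite -[_ == _]negbK patt // uv.
have c0 u k : (u < 7)%N -> (k < 7)%N -> fano_dot k k ->
    fano_dot u k = false -> c u k = 0.
  by move=> u7 k7 kk uk; apply/eqP; rewrite -[_ == _]negbK cn0 // uk.
have r0 u k : (u < 7)%N -> (k < 7)%N -> fano_dot k u = false -> r k u = 0.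
  by move=> u7 k7 uk; apply/eqP; rewrite -[_ == _]negbK patt // uk.
(* Index 2 is the sum of the first two basis vectors, so the zeros at (2, 2), (2, 6) and (6, 2) are
   relations in two coordinates only. Indices 4 and 5 serve the other two pairs of coordinates
   likewise. *)
have e01 : c 6%N 0%N * r 0%N 6%N + c 6%N 1%N * r 1%N 6%N = 0.
  apply: (@fano_ratios _ (c 2 0)%N (c 2 1)%N (r 0 2)%N (r 1 2)%N); rewrite ?cn0 ?patt //.
  - by have := zero 2%N 2%N isT isT erefl; rewrite (c0 2%N 3%N) // mul0r addr0.
  - by have := zero 2%N 6%N isT isT erefl; rewrite (c0 2%N 3%N) // mul0r addr0.
  - by have := zero 6%N 2%N isT isT erefl; rewrite (r0 2%N 3%N) // mulr0 addr0.
have e03 : c 6%N 0%N * r 0%N 6%N + c 6%N 3%N * r 3%N 6%N = 0.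
  apply: (@fano_ratios _ (c 4 0)%N (c 4 3)%N (r 0 4)%N (r 3 4)%N); rewrite ?cn0 ?patt //.
  - by have := zero 4%N 4%N isT isT erefl; rewrite (c0 4%N 1%N) // mul0r addr0.
  - by have := zero 4%N 6%N isT isT erefl; rewrite (c0 4%N 1%N) // mul0r addr0.
  - by have := zero 6%N 4%N isT isT erefl; rewrite (r0 4%N 1%N) // mulr0 addr0.
have e13 : c 6%N 1%N * r 1%N 6%N + c 6%N 3%N * r 3%N 6%N = 0.
  apply: (@fano_ratios _ (c 5 1)%N (c 5 3)%N (r 1 5)%N (r 3 5)%N); rewrite ?cn0 ?patt //.
  - by have := zero 5%N 5%N isT isT erefl; rewrite (c0 5%N 0%N) // mul0r add0r.
  - by have := zero 5%N 6%N isT isT erefl; rewrite (c0 5%N 0%N) // mul0r add0r.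
  - by have := zero 6%N 5%N isT isT erefl; rewrite (r0 5%N 0%N) // mulr0 add0r.
move: e01 e03 e13; set x := c 6%N 0%N * _; set y := c 6%N 1%N * _.
set z := c 6%N 3%N * _ => xy xz yz.
have x0 : x != 0 by rewrite mulf_neq0 ?cn0 ?patt.
have : 2%:R * x = 0.
  by transitivity (x + y + (x + z) - (y + z)); [ring | rewrite xy xz yz; ring].
by move/eqP; rewrite mulf_eq0 (negPf x0) orbF => /eqP.
Qed.

(** The witness is the Gram matrix of the seven non-zero vectors of F_2^3, each taken once as a
    point and once as a line. *)
Lemma fano_rank3_F2 : corank_set fano_pattern 'F_2 14 11 != set0.
Proof.
pose h (i : nat) := (if i < 7 then i else i - 7)%N.
pose U : 'M['F_2]_(3, 14) := \matrix_(k, i) (fano_bit (h i) k)%:R.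
apply/set0Pn; exists (U^T *m U); rewrite inE inE; apply/andP; split.
  rewrite trmx_mul trmxK eqxx /=.
  apply/forallP => i; apply/forallP => j; apply/implyP => ij.
  rewrite /fano_pattern; case: ifP => // /andP[i7 j7].
  rewrite mxE !big_ord_recl big_ord0 !mxE /h i7 ltnNge j7 /= /fano_dot.
  do 3!case: (fano_bit i _); do 3! case: (fano_bit (j - 7) _); by [].
rewrite -[14%N]/(3 + 11)%N eqn_add2r.
rewrite eqn_leq (leq_trans (mxrankM_maxl _ _)) ?rank_leq_col //=.
pose f (k : 'I_3) : 'I_14 := inord (nth 0%N [:: 0; 1; 3]%N k).
(* The columns of [U] at the basis vectors form the identity, so [U^T *m U] contains an identity
   block of size 3 and has rank at least 3. *)
have U1 : U *m colsub f 1%:M = 1%:M.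
  rewrite mulmx_colsub mulmx1; apply/matrixP => k l; rewrite !mxE.
  have -> : f l = nth 0%N [:: 0; 1; 3]%N l :> nat.
    by rewrite inordK //; case: l => -[|[|[|]]].
  by case: k l => -[|[|[|]]] // ? [] -[|[|[|]]].
set S := colsub f 1%:M in U1.
have SUUS : S^T *m (U^T *m U) *m S = 1%:M.
  by rewrite -mulmxA -[U^T *m U *m S]mulmxA U1 mulmx1 -trmx_mul U1 trmx1.
apply: (@leq_trans (\rank (1%:M : 'M['F_2]_3))); first by rewrite mxrank1.
by rewrite -SUUS (leq_trans (mxrankM_maxl _ _)) // mxrankM_maxr.
Qed.

Lemma odd_primes n :
  exists s : seq nat, [/\ size s = n, uniq s & all (fun p => prime p && (2 < p)%N) s].
Proof.
elim: n => [|n [s [<- us ps]]]; first by exists [::].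
have [p ltp pp] := prime_above (sumn s + 2).
exists (p :: s); rewrite /= us ps pp (leq_ltn_trans _ ltp) ?leq_addl //; split=> //.
(* A member of [s] is at most [sumn s], while [p] exceeds it. *)
rewrite andbT; apply/negP => /(@perm_to_rem _ _ _)/perm_sumn /= E.
by move: ltp; rewrite E; lia.
Qed.

Theorem mainTheorem3 : exists G : graph, ~ polynomially_countable G.
Proof.
apply: NNPP => /not_ex_not_all all_countable.
have [d [f [d0 E]]] := corank_rationally_countable fano_pattern 14 11 all_countable.
(* The count is zero over [F_p] for every odd prime [p], which gives [f] more roots than its degree
   allows. *)
have f0 : f = 0.
  apply/eqP; apply: contraT => fn0.
  have [s [ss us /allP ps]] := odd_primes (size f).
  have := @max_poly_roots _ f [seq p%:Z | p <- s] fn0.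
  rewrite size_map ss ltnn; apply; last by rewrite map_inj_uniq // => ? ? [].
  apply/allP => _ /mapP[p sp ->]; have /andP[pp p2] := ps p sp.
  rewrite /root -{1}(card_Fp pp) -E (_ : corank_set _ _ _ _ = set0).
    by rewrite cards0 mulr0.
  apply/eqP; apply: contraT => /fano_rank3_char2/eqP.
  rewrite -(dvdn_pcharf (pchar_Fp pp)) => /dvdn_leq; lia.
(* Since [d] does not vanish at 2, the count over [F_2] would have to be zero. *)
have /eqP := E 'F_2; rewrite f0 horner0 mulf_eq0 card_Fp // (negPf (d0 2%N _)) //=.
by rewrite eqz_nat cards_eq0 (negPf fano_rank3_F2).
Qed.
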